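(* Let $\mathbb{U}$ be a set of inputs, $J\neq\emptyset$ an index set, and $\Psi=\{H_j:\mathbb{U}^{*}\to\mathbb{R}^{n_y}\}_{j\in J}$ a family of maps. Then the following hold. (A) $\Psi$ can be realized by a state-linear system (SLS) which is globally uniformly exponentially stable (GUES) if and only if $\Psi$ is uniformly decaying (UD) and $\Psi$ has a finite Hankel-rank. (B) If $\Psi$ is uniformly exponentially decaying (UED) with rate $\beta$, then all minimal SLS realizations of $\Psi$ are GUES with rate $\beta$. (C) If $\Psi$ has a finite Hankel-rank and $\Psi$ is UD, then $\Psi$ is also UED (i.e. UED with some rate $\beta\in(0,1)$).
   Context: Words: for a set $X$, $X^{*}$ is the set of all finite words over $X$, including the empty word $\epsilon$; $|w|$ is the length of $w$, $w[k]$ its $k$-th letter, and $vw$ denotes concatenation. For a family $\{A_x\}_{x\in X}$ of $n\times n$ matrices and $w\in X^{*}$, $A_w=A_{w[|w|]}\cdots A_{w[1]}$ for nonempty $w$ and $A_\epsilon=I_n$. $\|\cdot\|_2$ is the Euclidean norm of vectors and the spectral norm of matrices. A state-linear system (SLS) is a tuple $\Sigma=(\{A_u\}_{u\in\mathbb{U}},B,C)$ with $A_u\in\mathbb{R}^{n\times n}$ for $u\in\mathbb{U}$, $C\in\mathbb{R}^{n_y\times n}$, and $B=\{B_j\}_{j\in J}$ a family of initial states $B_j\in\mathbb{R}^n$. It represents $x(t+1)=A_{u(t)}x(t)$, $x(0)\in B$, $y(t)=Cx(t)$. Its dimension is $\dim(\Sigma)=n$. $\Sigma$ is a realization of $\Psi$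 if $H_j(w)=CA_wB_j$ for all $w\in\mathbb{U}^{*}$, $j\in J$. It is a minimal SLS realization of $\Psi$ if its dimension is minimal among all SLS realizations of $\Psi$. Hankel-rank: for $H:\mathbb{U}^{*}\to\mathbb{R}^{n_y}$ and $v\in\mathbb{U}^{*}$, let $v\circ H:\mathbb{U}^{*}\ni w\mapsto H(vw)$. The Hankel-space is $W_\Psi=\mathrm{Span}\{v\circ H_j\mid j\in J,\ v\in\mathbb{U}^{*}\}$ (pointwise linear operations), and the Hankel-rank of $\Psi$ is $\dim W_\Psi$. GUES: an SLS is globally uniformly exponentially stable (GUES) with (decay) rate $\beta\in(0,1)$ if the set of initial states $\{B_j\}_{j\in J}$ is bounded and there is $C_g\ge 1$ such that $\|A_w\|_2\le C_g\beta^{|w|}$ for all $w\in\mathbb{U}^{*}$. It is GUES if it is GUES with some rate $\beta\in(0,1)$. UD: $\Psi$ is uniformly decaying (UD) if $\sup_{w\in\mathbb{U}^{*},\,j\in J}\|H_j(w)\|_2<+\infty$ and $\lim_{t\to\infty}\sup_{w\in\mathbb{U}^{*},\,|w|=t,\,j\in J}\|H_j(w)\|_2=0$. UED: $\Psi$ is uniformly exponentially decaying (UED) with rate $\beta\in(0,1)$ if there is $C_{ed}\ge 1$ such that $\sup_{j\in J}\|H_j(w)\|_2\le C_{ed}\beta^{|w|}$ for all $w\in\mathbb{U}^{*}$. *)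

(* Defs.v *)
From HB Require Import structures.
From mathcomp Require Import all_boot all_order all_algebra.
From mathcomp Require Import all_classical all_reals all_analysis.

Set Implicit Arguments.
Unset Strict Implicit.
Unset Printing Implicit Defensive.

Import Order.TTheory GRing.Theory Num.Theory.
Import numFieldNormedType.Exports.

Local Open Scope classical_set_scope.
Local Open Scope ring_scope.

Section Norms.
Variable R : realType.

(* The norm carried by matrices in the library is the max norm of the entries,
   so the Euclidean and spectral norms are introduced here. *)
Definition l2norm (n : nat) (x : 'cV[R]_n) : R :=
  Num.sqrt (\sum_(i < n) x i 0 ^+ 2).

Definition spectral_norm (m n : nat) (A : 'M[R]_(m, n)) : R :=
  sup [set l2norm (A *m x) | x in [set x : 'cV[R]_n | l2norm x <= 1]].

(* Supremum of a family of nonnegative numbers, taken in [0, +oo]: an unbounded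
   family has supremum +oo and the empty one has supremum 0 (the latter occurs
   for words of positive length when there are no letters). *)
Definition nnsup (I : Type) (P : set I) (f : I -> R) : \bar R :=
  ereal_sup (0%E |` [set (f i)%:E | i in P]).

End Norms.

Section Dimension.
Variables (R : realType) (V : lmodType R).

Definition linspan (S : set V) : set V :=
  [set v | exists (m : nat) (a : 'I_m -> R) (s : 'I_m -> V),
      (forall i, S (s i)) /\ v = \sum_(i < m) a i *: s i].

Definition linindep (d : nat) (b : 'I_d -> V) : Prop :=
  forall a : 'I_d -> R, \sum_(i < d) a i *: b i = 0 -> forall i, a i = 0.

(* W is a finite-dimensional subspace of V, of dimension d. *)
Definition has_dim (W : set V) (d : nat) : Prop :=
  exists b : 'I_d -> V, linindep b /\ linspan (range b) = W.

End Dimension.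

Section StateLinearSystems.
Variables (R : realType) (U J : Type) (ny : nat).

(* The state space may be zero-dimensional: the zero family is realized in
   dimension 0. *)
Record sls : Type := SLS {
  sls_dim : nat;
  sls_A : U -> 'M[R]_sls_dim;
  sls_B : J -> 'cV[R]_sls_dim;
  sls_C : 'M[R]_(ny, sls_dim)
}.

(* mxword A [:: u1; ...; uk] = A uk *m ... *m A u1. *)
Definition mxword (n : nat) (A : U -> 'M[R]_n) (w : seq U) : 'M[R]_n :=
  foldl (fun M u => A u *m M) 1%:M w.

Definition realizes (S : sls) (Psi : J -> seq U -> 'cV[R]_ny) : Prop :=
  forall (j : J) (w : seq U),
    Psi j w = sls_C S *m mxword (@sls_A S) w *m sls_B S j.

Definition minimal_realization (S : sls) (Psi : J -> seq U -> 'cV[R]_ny) :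
    Prop :=
  realizes S Psi /\
  forall S' : sls, realizes S' Psi -> (sls_dim S <= sls_dim S')%N.

Definition GUES_rate (S : sls) (beta : R) : Prop :=
  [/\ 0 < beta < 1,
      exists M : R, forall j : J, l2norm (sls_B S j) <= M
    & exists Cg : R, 1 <= Cg /\
        forall w : seq U,
          spectral_norm (mxword (@sls_A S) w) <= Cg * beta ^+ size w].

Definition GUES (S : sls) : Prop := exists beta : R, GUES_rate S beta.

Definition shift (v : seq U) (H : seq U -> 'cV[R]_ny) : seq U -> 'cV[R]_ny :=
  fun w => H (v ++ w).

(* The ambient vector space seq U -> 'cV[R]_ny carries the pointwise linear
   operations. *)
Definition hankel_space (Psi : J -> seq U -> 'cV[R]_ny) :
    set (seq U -> 'cV[R]_ny) :=
  linspan [set F | exists (j : J) (v : seq U), F = shift v (Psi j)].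

Definition hankel_rank (Psi : J -> seq U -> 'cV[R]_ny) (d : nat) : Prop :=
  has_dim (hankel_space Psi) d.

Definition finite_hankel_rank (Psi : J -> seq U -> 'cV[R]_ny) : Prop :=
  exists d : nat, hankel_rank Psi d.

Definition UD (Psi : J -> seq U -> 'cV[R]_ny) : Prop :=
  (nnsup [set: seq U * J] (fun wj => l2norm (Psi wj.2 wj.1)) < +oo)%E /\
  nnsup [set wj : seq U * J | size wj.1 = t]
    (fun wj => l2norm (Psi wj.2 wj.1)) @[t --> \oo] --> 0%E.

Definition UED_rate (Psi : J -> seq U -> 'cV[R]_ny) (beta : R) : Prop :=
  0 < beta < 1 /\
  exists Ced : R, 1 <= Ced /\
    forall w : seq U,
      (nnsup [set: J] (fun j => l2norm (Psi j w))
        <= (Ced * beta ^+ size w)%:E)%E.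

Definition UED (Psi : J -> seq U -> 'cV[R]_ny) : Prop :=
  exists beta : R, UED_rate Psi beta.

End StateLinearSystems.

(* Main.v *)
Require Import Defs.
From mathcomp Require Import all_boot all_order all_algebra.
From mathcomp Require Import all_classical all_reals all_analysis.
From mathcomp Require Import lra.

(** The Hankel space W carries the canonical realization of Psi: the states are
    the elements of W, the letter u acts by the left shift, and the output is
    the value at the empty word.  Conversely, a realization of dimension n maps
    its state space linearly onto a space of output functions that contains W,
    so the Hankel rank is at most n.  Hence Psi has a realization exactly when
    its Hankel rank is finite, and the minimal realizations are those of
    dimension the Hankel rank (hankel_realization,
    finite_hankel_rank_realizes, minimal_hankel_rank).

    In a realization of that dimension n, a basis of W comes from n states
    forming an invertible matrix X (hankel_rank_dim_unitmx), which forces the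
    state-to-output map to be injective; by finite dimension, finitely many
    output coordinates then determine the state linearly through a matrix L
    (observable_reconstruction).  Therefore

      A_w = L G_w X^-1,

    where the entries of G_w are values, at words wv, of elements of W, that is
    fixed linear combinations of values of Psi at words at least as long as w.
    So the norm of A_w is at most a constant times any bound on Psi valid on
    the words of length at least |w| (transition_decay).

    An exponential bound on Psi is thus inherited, at the same rate, by every
    minimal realization (UED_GUES_rate).  If Psi is only uniformly decaying,
    the bound gives a length T with spectral norm of A_w at most 1/2 for
    |w| = T, and submultiplicativity along blocks of length T upgrades this to
    an exponential bound (UD_GUES).  Finally a GUES realization of Psi makes
    Psi exponentially decaying (GUES_UED), which closes the circle. *)

Set Implicit Arguments.
Unset Strict Implicit.
Unset Printing Implicit Defensive.

Import Order.TTheory GRing.Theory Num.Theory.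
Import numFieldNormedType.Exports.

Local Open Scope classical_set_scope.
Local Open Scope ring_scope.

(** * Euclidean and spectral norms *)

Section Norms.
Context {R : realType}.

Lemma l2norm_ge0 n (x : 'cV[R]_n) : 0 <= l2norm x.
Proof. exact: sqrtr_ge0. Qed.

Lemma l2norm0 n : l2norm (0 : 'cV[R]_n) = 0.
Proof.
by rewrite /l2norm big1 ?sqrtr0 // => i _; rewrite mxE expr0n.
Qed.

Lemma l2normZ n (a : R) (x : 'cV[R]_n) : l2norm (a *: x) = `|a| * l2norm x.
Proof.
rewrite /l2norm -sqrtr_sqr -sqrtrM ?sqr_ge0 //; congr Num.sqrt.
by rewrite mulr_sumr; apply: eq_bigr => i _; rewrite mxE exprMn.
Qed.

Lemma ler_coord_l2norm n (x : 'cV[R]_n) i : `|x i 0| <= l2norm x.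
Proof.
rewrite -sqrtr_sqr /l2norm ler_wsqrtr // (bigD1 i) //= lerDl.
by apply: sumr_ge0 => j _; exact: sqr_ge0.
Qed.

Lemma l2norm_eq0 n (x : 'cV[R]_n) : l2norm x = 0 -> x = 0.
Proof.
move=> x0; apply/matrixP => i j; rewrite !mxE (ord1 j); apply/eqP.
by rewrite -normr_le0 -x0 ler_coord_l2norm.
Qed.

Lemma l2norm_le_sum n (x : 'cV[R]_n) : l2norm x <= \sum_i `|x i 0|.
Proof.
have sum_ge0 (P : pred 'I_n) : 0 <= \sum_(i | P i) `|x i 0|.
  by apply: sumr_ge0 => i _.
rewrite -[leRHS]ger0_norm // -sqrtr_sqr ler_wsqrtr //.
rewrite expr2 mulr_suml; apply: ler_sum => i _.
rewrite -real_normK ?num_real // expr2 ler_wpM2l //.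
by rewrite (bigD1 i) //= lerDl.
Qed.

(** This crude bound shows that the supremum defining the spectral norm is
    taken over a bounded set. *)
Lemma l2norm_mulmx_le_sum m n (A : 'M[R]_(m, n)) (x : 'cV[R]_n) :
  l2norm (A *m x) <= (\sum_i \sum_j `|A i j|) * l2norm x.
Proof.
apply: (le_trans (l2norm_le_sum _)); rewrite mulr_suml.
apply: ler_sum => i _; rewrite mxE mulr_suml.
apply: (le_trans (ler_norm_sum _ _ _)); apply: ler_sum => j _.
by rewrite normrM ler_wpM2l // ler_coord_l2norm.
Qed.

Lemma spectral_norm_le m n (A : 'M[R]_(m, n)) c : 0 <= c ->
  (forall x, l2norm (A *m x) <= c * l2norm x) -> spectral_norm A <= c.
Proof.
move=> c_ge0 Ac; apply: ge_sup.
  by exists (l2norm (A *m 0)), 0 => //=; rewrite l2norm0.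
move=> _ [x /= x1 <-]; apply: (le_trans (Ac x)).
by rewrite -[leRHS]mulr1 ler_wpM2l.
Qed.

Lemma spectral_norm_le_sum m n (A : 'M[R]_(m, n)) :
  spectral_norm A <= \sum_i \sum_j `|A i j|.
Proof.
apply: spectral_norm_le => [|x]; last exact: l2norm_mulmx_le_sum.
by apply: sumr_ge0 => i _; apply: sumr_ge0.
Qed.

Lemma spectral_norm_ubound m n (A : 'M[R]_(m, n)) x :
  l2norm x <= 1 -> l2norm (A *m x) <= spectral_norm A.
Proof.
move=> x1; apply: ub_le_sup; last by exists x.
exists (\sum_i \sum_j `|A i j|) => _ [y /= y1 <-].
apply: (le_trans (l2norm_mulmx_le_sum A y)).
rewrite -[leRHS]mulr1 ler_wpM2l //.
by apply: sumr_ge0 => i _; apply: sumr_ge0.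
Qed.

Lemma spectral_norm_ge0 m n (A : 'M[R]_(m, n)) : 0 <= spectral_norm A.
Proof.
apply: (le_trans (l2norm_ge0 (A *m 0))).
by apply: spectral_norm_ubound; rewrite l2norm0.
Qed.

Lemma l2norm_mulmx m n (A : 'M[R]_(m, n)) x :
  l2norm (A *m x) <= spectral_norm A * l2norm x.
Proof.
have [x0|x0] := eqVneq (l2norm x) 0.
  by rewrite (l2norm_eq0 x0) mulmx0 !l2norm0 mulr0.
have xgt0 : 0 < l2norm x by rewrite lt_def x0 l2norm_ge0.
have := @spectral_norm_ubound _ _ A ((l2norm x)^-1 *: x).
rewrite -scalemxAr !l2normZ gtr0_norm ?invr_gt0 // mulVf // lexx => /(_ isT).
by rewrite ler_pdivrMl // mulrC.
Qed.

Lemma spectral_norm_mulmx m n p (A : 'M[R]_(m, n)) (B : 'M[R]_(n, p)) :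
  spectral_norm (A *m B) <= spectral_norm A * spectral_norm B.
Proof.
apply: spectral_norm_le => [|x]; first by rewrite mulr_ge0 ?spectral_norm_ge0.
rewrite -mulmxA -mulrA; apply: (le_trans (l2norm_mulmx _ _)).
by rewrite ler_wpM2l ?spectral_norm_ge0 ?l2norm_mulmx.
Qed.

End Norms.

(** * Spans and independent families *)

Section Span.
Context {R : realType} {V : lmodType R}.
Implicit Types S T : set V.

Lemma linspan_gen S x : S x -> linspan S x.
Proof.
by move=> Sx; exists 1%N, (fun=> 1), (fun=> x); rewrite big_ord1 scale1r.
Qed.

Lemma linspanZ S a x : linspan S x -> linspan S (a *: x).
Proof.
move=> [m [c [s [Ss ->]]]]; exists m, (fun i => a * c i), s; split=> //.
by rewrite scaler_sumr; apply: eq_bigr => i _; rewrite scalerA.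
Qed.

Lemma linspanD S x y : linspan S x -> linspan S y -> linspan S (x + y).
Proof.
move=> [m [c [s [Ss ->]]]] [p [d [t [St ->]]]].
exists (m + p)%N,
  (fun i => match fintype.split i with inl j => c j | inr j => d j end),
  (fun i => match fintype.split i with inl j => s j | inr j => t j end).
split; first by move=> i; case: (fintype.split i).
rewrite big_split_ord /=; congr (_ + _); apply: eq_bigr => i _.
  by rewrite (unsplitK (inl i)).
by rewrite (unsplitK (inr i)).
Qed.

Lemma linspan_sum S n (f : 'I_n -> V) :
  (forall i, linspan S (f i)) -> linspan S (\sum_i f i).
Proof.
move=> Sf; apply: big_ind => [||i _]; last exact: Sf.
  by exists 0%N, (fun=> 0), (fun=> 0); split=> [[]|]; rewrite ?big_ord0.
by move=> x y; exact: linspanD.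
Qed.

Lemma linspan_min S T : S `<=` linspan T -> linspan S `<=` linspan T.
Proof.
move=> ST _ [m [a [s [Ss ->]]]].
by apply: linspan_sum => i; apply: linspanZ; exact: ST.
Qed.

Lemma linspan_rangeP n (b : 'I_n -> V) x :
  linspan (range b) x <-> exists a : 'I_n -> R, x = \sum_i a i *: b i.
Proof.
split=> [[m [c [s [Ss ->]]]]|[a ->]]; last first.
  by exists n, a, b; split=> // i; exists i.
have /choice[f fE] : forall i, exists k, b k = s i.
  by move=> i; have [k _ <-] := Ss i; exists k.
(* The s i may repeat elements of b, so coefficients are summed over fibres. *)
exists (fun k => \sum_(i | f i == k) c i).
rewrite (partition_big f xpredT) //=; apply: eq_bigr => k _.
by rewrite scaler_suml; apply: eq_bigr => i /eqP <-; rewrite fE.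
Qed.

(** The coefficient matrix of c over b has independent rows, hence at most as
    many rows as columns. *)
Lemma linindep_le n d (b : 'I_n -> V) (c : 'I_d -> V) :
  linindep c -> (forall i, linspan (range b) (c i)) -> (d <= n)%N.
Proof.
move=> c_free cb.
have /choice[a aE] : forall i, exists a : 'I_n -> R, c i = \sum_k a k *: b k.
  by move=> i; apply/linspan_rangeP.
pose M : 'M[R]_(d, n) := \matrix_(i, k) a i k.
have /eqP <- : row_free M; last exact: rank_leq_col.
apply: inj_row_free => v vM0; apply/rowP => i; rewrite mxE.
apply: (c_free (v 0)) => {i}.
under eq_bigr do rewrite aE scaler_sumr.
rewrite exchange_big big1 //= => k _.
under eq_bigr do rewrite scalerA.
rewrite -scaler_suml; have /rowP/(_ k) := vM0.
by rewrite !mxE; under eq_bigr do rewrite mxE; move=> ->; rewrite scale0r.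
Qed.

Lemma linindep_rcons d (c : 'I_d -> V) x : linindep c ->
  ~ linspan (range c) x ->
  linindep (fun i : 'I_d.+1 => if unlift ord_max i is Some j then c j else x).
Proof.
move=> c_free xNc a; rewrite big_ord_recr /= unlift_none.
under eq_bigr => i _.
  rewrite (_ : widen_ord _ i = lift ord_max i) ?liftK; last first.
    by apply: val_inj; exact/esym/lift_max.
  over.
move=> /= sum0; have a0 : a ord_max = 0.
  apply: contrapT => /eqP a0; apply: xNc; apply/linspan_rangeP.
  exists (fun i => - ((a ord_max)^-1 * a (lift ord_max i))).
  move/eqP: sum0; rewrite addrC addr_eq0 => /eqP axE.
  rewrite -[LHS](scalerK a0) axE scalerN scaler_sumr -sumrN.
  by apply: eq_bigr => i _; rewrite scalerA scaleNr.
rewrite a0 scale0r addr0 in sum0 => i.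
case: (unliftP ord_max i) => [j ->|-> //].
exact: (c_free (fun i => a (lift ord_max i))).
Qed.

(** By linindep_le the independent families of elements of S have bounded size;
    a maximal one spans S, since otherwise linindep_rcons would extend it. *)
Lemma linspan_basis n (b : 'I_n -> V) S : S `<=` linspan (range b) ->
  exists d (c : 'I_d -> V), [/\ (d <= n)%N, forall i, S (c i),
    linindep c & linspan (range c) = linspan S].
Proof.
move=> Sb.
pose P d := `[< exists c : 'I_d -> V, (forall i, S (c i)) /\ linindep c >].
have exP : exists d, P d.
  by exists 0%N; apply/asboolP; exists (fun=> 0); split=> [[]|? _ []].
have leP d : P d -> (d <= n)%N.
  by move=> /asboolP[c [Sc c_free]]; apply: (linindep_le c_free) => i; exact: Sb.
case: (ex_maxnP exP leP) => d Pd dmax; have /asboolP[c [Sc c_free]] := Pd.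
exists d, c; split=> //; first exact: leP.
rewrite eqEsubset; split; apply: linspan_min.
  by move=> _ [i _ <-]; exact: linspan_gen.
move=> x Sx; apply: contrapT => xNc.
have /dmax : P d.+1; last by rewrite ltnn.
apply/asboolP; eexists; split; last exact: (linindep_rcons c_free xNc).
by move=> i /=; case: unlift.
Qed.

End Span.

(** * Decay of families of maps *)

Section Decay.
Context {R : realType}.

(** For c < 0 the left side fails even on an empty family, whose nnsup is 0. *)
Lemma nnsup_leP (I : Type) (P : set I) (f : I -> R) c : 0 <= c ->
  (nnsup P f <= c%:E)%E <-> (forall i, P i -> f i <= c).
Proof.
move=> c_ge0; split=> [supc i Pi|fc].
  rewrite -lee_fin (le_trans _ supc) //; apply: ereal_sup_ubound.
  by right; exists i.
apply: ge_ereal_sup => _ [->|[i Pi <-]]; rewrite lee_fin //; exact: fc.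
Qed.

Lemma nnsup_ge0 (I : Type) (P : set I) (f : I -> R) : (0 <= nnsup P f)%E.
Proof. by apply: ereal_sup_ubound; left. Qed.

Lemma nnsup_fin_bound (I : Type) (P : set I) (f : I -> R) :
  (nnsup P f < +oo)%E -> exists2 c, 0 <= c & forall i, P i -> f i <= c.
Proof.
move=> sup_fin; have sup_ge0 := nnsup_ge0 P f.
have c_ge0 : 0 <= fine (nnsup P f) by exact: fine_ge0.
exists (fine (nnsup P f)) => //; apply/(nnsup_leP _ _ c_ge0).
by rewrite fineK // ge0_fin_numE.
Qed.

Lemma bernoulli_ineq (x : R) n : 0 <= x <= 1 -> 1 - n%:R * x <= (1 - x) ^+ n.
Proof.
move=> /andP[x0 x1]; elim: n => [|n IHn]; first by rewrite mul0r subr0.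
rewrite exprS; apply: (@le_trans _ _ ((1 - x) * (1 - n%:R * x))); last first.
  by rewrite ler_wpM2l // subr_ge0.
have : 0 <= n%:R * x * x by rewrite !mulr_ge0.
by rewrite -natr1; nra.
Qed.

Context {U J : Type} {ny : nat}.
Implicit Type Psi : J -> seq U -> 'cV[R]_ny.

Lemma UED_rateP Psi beta : UED_rate Psi beta <-> 0 < beta < 1 /\
  exists c, 0 <= c /\ forall j w, l2norm (Psi j w) <= c * beta ^+ size w.
Proof.
split=> -[b01 [c [c_ge HPsi]]]; have [b0 _] := andP b01; split=> //.
  have c0 : 0 <= c by apply: le_trans c_ge.
  exists c; split=> // j w; have := HPsi w.
  by rewrite nnsup_leP ?mulr_ge0 ?exprn_ge0 ?(ltW b0) //; exact.
exists (c + 1); split=> [|w]; first by rewrite lerDr.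
rewrite nnsup_leP ?mulr_ge0 ?exprn_ge0 ?(ltW b0) ?addr_ge0 // => j _.
apply: (le_trans (HPsi j w)).
by rewrite ler_wpM2r ?lerDl // exprn_ge0 // ltW.
Qed.

Lemma UED_UD Psi : UED Psi -> UD Psi.
Proof.
move=> [beta /UED_rateP[/andP[b0 b1] [c [c0 HPsi]]]].
have pow_ge0 t : 0 <= c * beta ^+ t by rewrite mulr_ge0 // exprn_ge0 // ltW.
split.
  apply: (@le_lt_trans _ _ c%:E); last exact: ltry.
  apply/nnsup_leP => // -[w j] _ /=; apply: (le_trans (HPsi j w)).
  by rewrite -[leRHS]mulr1 ler_wpM2l // exprn_ile1 // ltW.
apply: (@squeeze_cvge _ _ _ _ (fun=> 0%E) _ (fun t => (c * beta ^+ t)%:E)).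
- apply: nearW => t; rewrite nnsup_ge0 /=; apply/nnsup_leP => //.
  by move=> [w j] /= <-.
- exact: cvg_cst.
- apply/fine_cvgP; split; first exact: nearW.
  rewrite -[X in _ --> X](mulr0 c); apply: cvgM; first exact: cvg_cst.
  by apply: cvg_expr; rewrite gtr0_norm.
Qed.

Lemma UD_bound Psi : UD Psi ->
  exists2 c, 0 <= c & forall j w, l2norm (Psi j w) <= c.
Proof.
move=> [/nnsup_fin_bound[c c0 HPsi] _].
by exists c => // j w; exact: (HPsi (w, j)).
Qed.

Lemma UD_small Psi e : UD Psi -> 0 < e ->
  exists T, forall j w, (T <= size w)%N -> l2norm (Psi j w) <= e.
Proof.
move=> [_ Psi0] e0.
have : \forall t \near \oo, (nnsup [set wj : seq U * J | size wj.1 = t]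
    (fun wj => l2norm (Psi wj.2 wj.1)) < e%:E)%E.
  have := @nbhs_open_ereal_lt R 0 (fun=> e) e0.
  by move/Psi0.
move=> [T _ HT]; exists T => j w /HT /= /ltW.
by rewrite nnsup_leP ?(ltW e0) // => /(_ (w, j)); exact.
Qed.

End Decay.

(** * Realizations and the Hankel space *)

(* The topology library also defines a function called shift. *)
Local Notation shift := Defs.shift.

Section Words.
Context {R : realType} {U : Type}.

Lemma mxword_rcons n (A : U -> 'M[R]_n) w u :
  mxword A (rcons w u) = A u *m mxword A w.
Proof. by rewrite /mxword -cats1 foldl_cat. Qed.

Lemma mxword_cat n (A : U -> 'M[R]_n) v w :
  mxword A (v ++ w) = mxword A w *m mxword A v.
Proof.
elim/last_ind: w => [|w u IHw]; first by rewrite cats0 mul1mx.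
by rewrite -rcons_cat !mxword_rcons IHw mulmxA.
Qed.

End Words.

Section Systems.
Context {R : realType} {U J : Type} {ny : nat}.
Implicit Types (S : sls R U J ny) (Psi : J -> seq U -> 'cV[R]_ny).

(** The infinite observability matrix, as a map. *)
Definition output_map S (x : 'cV[R]_(sls_dim S)) (w : seq U) : 'cV[R]_ny :=
  sls_C S *m mxword (sls_A S) w *m x.
Arguments output_map : clear implicits.

Lemma output_map_sum S n (a : 'I_n -> R) (x : 'I_n -> 'cV[R]_(sls_dim S)) :
  output_map S (\sum_i a i *: x i) = \sum_i a i *: output_map S (x i).
Proof.
apply/funext => w; rewrite /output_map mulmx_sumr fct_sumE.
by apply: eq_bigr => i _; rewrite -scalemxAr.
Qed.

Lemma output_map_shift S v x w :
  output_map S (mxword (sls_A S) v *m x) w = output_map S x (v ++ w).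
Proof. by rewrite /output_map mxword_cat !mulmxA. Qed.

Lemma output_map_word S x w :
  output_map S (mxword (sls_A S) w *m x) = shift w (output_map S x).
Proof. by apply/funext => v; exact: output_map_shift. Qed.

Lemma realizes_output_map S Psi : realizes S Psi ->
  forall j, Psi j = output_map S (sls_B S j).
Proof. by move=> SPsi j; apply/funext => w; rewrite SPsi. Qed.

Lemma hankel_space_output S Psi F : realizes S Psi ->
  hankel_space Psi F -> exists x, F = output_map S x.
Proof.
move=> SPsi [m [a [s [sP ->]]]].
have /choice[x xE] i : exists x, s i = output_map S x.
  have [j [v ->]] := sP i; exists (mxword (sls_A S) v *m sls_B S j).
  by rewrite output_map_word (realizes_output_map SPsi).
exists (\sum_i a i *: x i); rewrite output_map_sum.
by apply: eq_bigr => i _; rewrite xE.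
Qed.

Lemma mulmx_delta_sum n (x : 'cV[R]_n) :
  x = \sum_i x i 0 *: (delta_mx i 0 : 'cV[R]_n).
Proof.
rewrite [LHS]matrix_sum_delta; apply: eq_bigr => i _.
by rewrite big_ord1.
Qed.

(** The outputs of the canonical basis states span a space containing the
    Hankel space. *)
Lemma finite_hankel_rank_realizes S Psi : realizes S Psi ->
  exists2 d, (d <= sls_dim S)%N & hankel_rank Psi d.
Proof.
move=> SPsi.
have [F [j [v ->]]|d [c [dn _ c_free cE]]] := @linspan_basis R _ (sls_dim S)
  (fun i => output_map S (delta_mx i 0))
  [set F | exists (j : J) (v : seq U), F = shift v (Psi j)].
  have [|x ->] := @hankel_space_output S Psi (shift v (Psi j)) SPsi.
    by apply: linspan_gen; exists j, v.
  apply/linspan_rangeP; exists (fun i => x i 0).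
  by rewrite -output_map_sum -mulmx_delta_sum.
by exists d => //; exists c.
Qed.

Lemma hankel_space_gen Psi j v : hankel_space Psi (shift v (Psi j)).
Proof. by apply: linspan_gen; exists j, v. Qed.

Lemma hankel_space_shift Psi u F : hankel_space Psi F ->
  hankel_space Psi (shift [:: u] F).
Proof.
move=> [m [a [s [sP ->]]]]; rewrite (_ : shift _ _ =
  \sum_i a i *: shift [:: u] (s i)); last first.
  by apply/funext => w; rewrite /shift !fct_sumE.
apply: linspan_sum => i; apply: linspanZ; have [j [v ->]] := sP i.
rewrite (_ : shift _ _ = shift (rcons v u) (Psi j)).
  exact: hankel_space_gen.
by apply/funext => w; rewrite /shift cat_rcons.
Qed.

(** States are coordinate vectors over a basis b of the Hankel space, which is
    stable under the shifts by letters; A u is the matrix of that shift, and C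
    evaluates at the empty word. *)
Lemma hankel_realization Psi d : hankel_rank Psi d ->
  exists S, sls_dim S = d /\ realizes S Psi.
Proof.
move=> [b [_ bE]].
have coord F : hankel_space Psi F -> exists x : 'cV[R]_d,
    F = \sum_i x i 0 *: b i.
  rewrite -bE => /linspan_rangeP[a ->]; exists (\col_i a i).
  by apply: eq_bigr => i _; rewrite mxE.
have /choice[B BE] j : exists x : 'cV[R]_d, Psi j = \sum_i x i 0 *: b i.
  exact/coord/(hankel_space_gen Psi j [::]).
have /choice[A AE] u : exists M : 'M[R]_d,
    forall k, shift [:: u] (b k) = \sum_i M i k *: b i.
  have /choice[x xE] k : exists x : 'cV[R]_d,
      shift [:: u] (b k) = \sum_i x i 0 *: b i.
    apply/coord/hankel_space_shift; rewrite -bE.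
    by apply: linspan_gen; exists k.
  exists (\matrix_(i, k) x k i 0) => k; rewrite xE.
  by apply: eq_bigr => i _; rewrite mxE.
pose S := @SLS R U J ny d A B (\matrix_(l, i) b i [::] l 0).
exists S; split=> // j w.
have shiftE (x : 'cV[R]_d) : shift w (\sum_i x i 0 *: b i) =
    \sum_i (mxword A w *m x) i 0 *: b i.
  elim/last_ind: w => [|w u IHw]; first by rewrite mul1mx.
  transitivity (shift [:: u] (shift w (\sum_i x i 0 *: b i))).
    by apply/funext => v; rewrite /shift cat_rcons.
  rewrite IHw mxword_rcons -mulmxA; set y := mxword A w *m x.
  transitivity (\sum_k y k 0 *: shift [:: u] (b k)).
    by apply/funext => v; rewrite /shift !fct_sumE.
  under eq_bigr => k _ do rewrite AE scaler_sumr.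
  rewrite exchange_big; apply: eq_bigr => i _.
  rewrite mxE scaler_suml; apply: eq_bigr => k _.
  by rewrite scalerA mulrC.
have -> : Psi j w = shift w (Psi j) [::] by rewrite /shift cats0.
rewrite BE shiftE -mulmxA; apply/colP => l.
rewrite fct_sumE summxE [RHS]mxE; apply: eq_bigr => i _.
by rewrite !mxE mulrC.
Qed.

(** By hankel_realization some realization has dimension the Hankel rank, which
    bounds all dimensions of realizations from below. *)
Lemma minimal_hankel_rank S Psi : minimal_realization S Psi ->
  hankel_rank Psi (sls_dim S).
Proof.
move=> [SPsi Smin]; have [d dS Psi_d] := finite_hankel_rank_realizes SPsi.
have [S' [S'd S'Psi]] := hankel_realization Psi_d.
suff -> : sls_dim S = d by [].
by apply/eqP; rewrite eqn_leq dS andbT -S'd Smin.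
Qed.

(** * Stability of realizations of minimal dimension *)

(** The columns of X are states whose output functions form a basis of the
    Hankel space; as there are as many as state coordinates, X is invertible
    and the independence of the basis becomes injectivity of output_map. *)
Lemma hankel_rank_dim_unitmx S Psi : realizes S Psi ->
  hankel_rank Psi (sls_dim S) ->
  exists X : 'M[R]_(sls_dim S), [/\ X \in unitmx,
    forall k, hankel_space Psi (output_map S (col k X)) &
    forall x, output_map S x = 0 -> x = 0].
Proof.
move=> SPsi [b [b_free bE]].
have bW k : hankel_space Psi (b k).
  by rewrite -bE; apply: linspan_gen; exists k.
have /choice[x xE] k := hankel_space_output SPsi (bW k).
pose X : 'M[R]_(sls_dim S) := \matrix_(i, k) x k i 0.
have colX k : col k X = x k by apply/colP => i; rewrite !mxE.
have XE y : X *m y = \sum_k y k 0 *: x k.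
  apply/colP => i; rewrite mxE summxE; apply: eq_bigr => k _.
  by rewrite !mxE mulrC.
have Xinj y : output_map S (X *m y) = 0 -> y = 0.
  rewrite XE output_map_sum; under eq_bigr do rewrite -xE.
  by move=> y0; apply/colP => k; rewrite mxE (b_free _ y0).
have Xu : X \in unitmx.
  rewrite -unitmx_tr -row_free_unit; apply: inj_row_free => v vX0.
  rewrite -[v]trmxK [v^T]Xinj ?trmx0 //.
  rewrite -[X]trmxK -trmx_mul vX0 trmx0.
  by apply/funext => w; rewrite /output_map mulmx0.
exists X; split=> // [k|y y0]; first by rewrite colX -xE.
by rewrite -[y](mulKVmx Xu) [invmx X *m y]Xinj ?mulmx0 // mulKVmx.
Qed.

(** The rows of the matrices C A_v span a finite-dimensional space.  A basis of
    it chosen among them gives a matrix N with trivial kernel, because a state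
    killed by N has zero output on every word; L is a left inverse of N. *)
Lemma observable_reconstruction S :
  (forall x, output_map S x = 0 -> x = 0) ->
  exists m (v : 'I_m -> seq U) (i : 'I_m -> 'I_ny) (L : 'M[R]_(sls_dim S, m)),
    forall x, x = L *m \col_l output_map S x (v l) (i l) 0.
Proof.
move=> Sobs; pose r v i := row i (sls_C S *m mxword (sls_A S) v).
have rE v i x : (r v i *m x) 0 0 = output_map S x v i 0.
  by rewrite -row_mul mxE.
pose rows : set 'rV[R]_(sls_dim S) := [set y | exists v i, y = r v i].
have rows_span : rows `<=` linspan (range (fun k => delta_mx 0 k)).
  by move=> y _; apply/linspan_rangeP; eexists; exact: row_sum_delta.
have [m [c [_ cr _ cE]]] := linspan_basis rows_span.
have /choice[vi viE] l : exists vi, c l = r vi.1 vi.2.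
  by have [v [i ->]] := cr l; exists (v, i).
pose N : 'M[R]_(m, sls_dim S) := \matrix_l c l.
have NE x : N *m x = \col_l output_map S x (vi l).1 (vi l).2 0.
  apply/colP => l.
  by rewrite [RHS]mxE -rE -viE -[c l](rowK c) -row_mul [RHS]mxE.
have : row_full N.
  rewrite /row_full -mxrank_tr -[_ == _]/(row_free N^T); apply: inj_row_free => y yN0.
  rewrite -[y]trmxK [y^T]Sobs ?trmx0 //; apply/funext => v.
  have Ny0 : N *m y^T = 0 by rewrite -[N]trmxK -trmx_mul yN0 trmx0.
  apply/colP => i; rewrite -rE.
  have : linspan (range c) (r v i) by rewrite cE; apply: linspan_gen; exists v, i.
  move=> /linspan_rangeP[a ->]; rewrite mulmx_suml summxE big1 ?mxE // => l _.
  rewrite -scalemxAl -[c l](rowK c) -row_mul -/N Ny0.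
  by rewrite !mxE mulr0.
move=> /row_fullP[L LN1]; exists m, (fun l => (vi l).1), (fun l => (vi l).2), L.
by move=> x; rewrite -NE mulmxA LN1 mul1mx.
Qed.

(** Shifting by v only lengthens words, so a bound on Psi valid from length T on
    passes to the elements of the Hankel space, up to the l1 norm of their
    coefficients.  The constant k precedes T and c: the same one serves for
    every threshold. *)
Lemma hankel_space_decay Psi F : hankel_space Psi F ->
  exists2 k, 0 <= k & forall T c, 0 <= c ->
    (forall j w, (T <= size w)%N -> l2norm (Psi j w) <= c) ->
    forall w i, (T <= size w)%N -> `|F w i 0| <= k * c.
Proof.
move=> [m [a [s [sP ->]]]]; exists (\sum_l `|a l|).
  by apply: sumr_ge0.
move=> T c c0 Psic w i Tw; rewrite fct_sumE summxE mulr_suml.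
apply: (le_trans (ler_norm_sum _ _ _)); apply: ler_sum => l _.
rewrite mxE normrM ler_wpM2l //; have [j [v ->]] := sP l.
apply: (le_trans (ler_coord_l2norm _ _)); apply: Psic.
by rewrite size_cat (leq_trans Tw) // leq_addl.
Qed.

(** The factorization A_w = L G_w X^-1, with G_w made of values at the words
    w ++ v l of the basis of the Hankel space.  That K does not depend on T and
    c is what makes the bound usable both for an exponential rate (T the length
    of w) and for mere uniform decay (T large). *)
Lemma transition_decay S Psi : realizes S Psi ->
  hankel_rank Psi (sls_dim S) ->
  exists2 K, 0 <= K & forall T c, 0 <= c ->
    (forall j w, (T <= size w)%N -> l2norm (Psi j w) <= c) ->
    forall w, (T <= size w)%N -> spectral_norm (mxword (sls_A S) w) <= K * c.
Proof.
move=> SPsi Sdim; have [X [Xu XW Sobs]] := hankel_rank_dim_unitmx SPsi Sdim.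
have [m [v [i [L LE]]]] := observable_reconstruction Sobs.
have /choice[k kP] p : exists k, 0 <= k /\ forall T c, 0 <= c ->
    (forall j w, (T <= size w)%N -> l2norm (Psi j w) <= c) ->
    forall w i, (T <= size w)%N -> `|output_map S (col p X) w i 0| <= k * c.
  by have [k k0 kP] := hankel_space_decay (XW p); exists k.
pose K := \sum_(l < m) \sum_p k p.
have K0 : 0 <= K.
  by apply: sumr_ge0 => l _; apply: sumr_ge0 => p _; have [] := kP p.
exists (spectral_norm L * K * spectral_norm (invmx X)).
  by rewrite !mulr_ge0 ?spectral_norm_ge0.
move=> T c c0 Psic w Tw.
pose G : 'M[R]_(m, sls_dim S) :=
  \matrix_(l, p) output_map S (col p X) (w ++ v l) (i l) 0.
have -> : mxword (sls_A S) w = L *m G *m invmx X.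
  rewrite -[LHS](mulmxK Xu); congr (_ *m _).
  apply/matrixP => q p.
  suff /colP/(_ q) : col p (mxword (sls_A S) w *m X) = col p (L *m G).
    by rewrite mxE [RHS]mxE.
  rewrite !colE -!mulmxA -!colE [LHS]LE; congr (_ *m _).
  by apply/colP => l; rewrite [LHS]mxE output_map_shift 2![RHS]mxE.
apply: (le_trans (spectral_norm_mulmx _ _)).
rewrite mulrAC ler_wpM2r ?spectral_norm_ge0 //.
apply: (le_trans (spectral_norm_mulmx _ _)).
rewrite -mulrA ler_wpM2l ?spectral_norm_ge0 //.
apply: (le_trans (spectral_norm_le_sum _)).
rewrite mulr_suml; apply: ler_sum => l _.
rewrite mulr_suml; apply: ler_sum => p _; rewrite mxE.
have [_ /(_ T c c0 Psic)] := kP p; apply.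
by rewrite size_cat (leq_trans Tw) // leq_addr.
Qed.

(** The initial state B j is read off finitely many values of Psi j, which are
    bounded uniformly in j. *)
Lemma initial_states_bounded S Psi c : realizes S Psi ->
  hankel_rank Psi (sls_dim S) -> 0 <= c ->
  (forall j w, l2norm (Psi j w) <= c) ->
  exists M, forall j, l2norm (sls_B S j) <= M.
Proof.
move=> SPsi Sdim c0 Psic; have [_ [_ _ Sobs]] := hankel_rank_dim_unitmx SPsi Sdim.
have [m [v [i [L LE]]]] := observable_reconstruction Sobs.
exists (spectral_norm L * \sum_(l < m) c) => j; rewrite [sls_B S j]LE.
apply: (le_trans (l2norm_mulmx _ _)); rewrite ler_wpM2l ?spectral_norm_ge0 //.
apply: (le_trans (l2norm_le_sum _)); apply: ler_sum => l _.
rewrite mxE -(realizes_output_map SPsi).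
exact: (le_trans (ler_coord_l2norm _ _)).
Qed.

Lemma UED_GUES_rate S Psi beta : realizes S Psi ->
  hankel_rank Psi (sls_dim S) -> UED_rate Psi beta -> GUES_rate S beta.
Proof.
move=> SPsi Sdim /UED_rateP[b01 [c [c0 HPsi]]]; have [b0 b1] := andP b01.
have pow_ge0 t : 0 <= c * beta ^+ t by rewrite mulr_ge0 // exprn_ge0 // ltW.
have decr t (w : seq U) : (t <= size w)%N -> c * beta ^+ size w <= c * beta ^+ t.
  by move=> tw; rewrite ler_wpM2l // ler_wiXn2l // ltW.
split=> //.
  apply: (initial_states_bounded SPsi Sdim c0) => j w.
  by apply: (le_trans (HPsi j w)); rewrite -[leRHS]mulr1 (decr 0%N w).
have [K K0 KP] := transition_decay SPsi Sdim.
exists (1 + K * c); split=> [|w]; first by rewrite lerDl mulr_ge0.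
apply: (@le_trans _ _ (K * (c * beta ^+ size w))).
  apply: (KP (size w)) => // j w' ww'; apply: (le_trans (HPsi j w')).
  exact: decr.
by rewrite mulrDl mul1r mulrA lerDr exprn_ge0 // ltW.
Qed.

(** If the norm of A_w is at most 1/2 on words of length at least T, cut w into
    blocks of length T: any beta with beta ^+ T >= 1/2 is a rate.  Taking
    beta = 1 - 1/(2T), Bernoulli's inequality gives this without extracting a
    T-th root. *)
Lemma UD_GUES S Psi : realizes S Psi -> hankel_rank Psi (sls_dim S) ->
  UD Psi -> GUES S.
Proof.
move=> SPsi Sdim PsiUD; have [c c0 Psic] := UD_bound PsiUD.
have [K K0 KP] := transition_decay SPsi Sdim.
(* The threshold 1 / (2 (K + 1)) makes K times it at most 1/2, even for K = 0. *)
have [T0 T0P] : exists T0, forall w, (T0 <= size w)%N ->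
    spectral_norm (mxword (sls_A S) w) <= 2^-1.
  have e0 : 0 < (2 * (K + 1))^-1 by rewrite invr_gt0 mulr_gt0 // ltr_wpDl.
  have [T0 small] := UD_small PsiUD e0.
  exists T0 => w Tw; apply: (le_trans (KP T0 _ (ltW e0) small w Tw)).
  rewrite invfM mulrCA ler_piMr ?invr_ge0 //.
  by rewrite ler_pdivrMr ?mul1r ?lerDl // ltr_wpDl.
(* The block length has to be positive. *)
pose T := T0.+1.
have TP w : (T <= size w)%N -> spectral_norm (mxword (sls_A S) w) <= 2^-1.
  by move=> Tw; apply: T0P; exact: ltnW.
have T1 : 1 <= T%:R :> R by rewrite ler1n.
pose x : R := (2 * T%:R)^-1; pose beta := 1 - x.
have x01 : 0 < x <= 2^-1.
  have T_gt0 : 0 < T%:R :> R by rewrite ltr0n.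
  by rewrite invr_gt0 mulr_gt0 //= lef_pV2 ?posrE ?mulr_gt0 // ler_peMr.
have b01 : 0 < beta < 1 by rewrite /beta; lra.
have [b0 b1] := andP b01.
have betaT : 2^-1 <= beta ^+ T.
  apply: le_trans (bernoulli_ineq _ _); last by lra.
  rewrite /x invfM mulrCA divff ?pnatr_eq0 // mulr1.
  by lra.
have bounded w : spectral_norm (mxword (sls_A S) w) <= K * c.
  by apply: (KP 0%N) => // j w' _; exact: Psic.
exists beta; split=> //; first exact: initial_states_bounded SPsi Sdim c0 Psic.
pose Cg := 1 + 2 * (K * c); have Kc0 : 0 <= K * c by rewrite mulr_ge0.
have Cg1 : 1 <= Cg by rewrite /Cg; lra.
(* Words shorter than T only satisfy the bound K * c, and there
   1/2 <= beta ^+ size w: hence the factor 2 in Cg. *)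
exists Cg; split=> // w; have [t] := ubnP (size w).
elim: t w => // t IHt w; rewrite ltnS => wt.
have [wT|Tw] := ltnP (size w) T.
  apply: (le_trans (bounded w)).
  have : 2^-1 <= beta ^+ size w.
    apply: (le_trans betaT).
    by rewrite ler_wiXn2l ?(ltW b0) ?(ltW b1) // ltnW.
  by rewrite /Cg; nra.
rewrite -(cat_take_drop T w) mxword_cat.
apply: (le_trans (spectral_norm_mulmx _ _)).
rewrite size_cat size_takel // [(T + _)%N]addnC exprD mulrA.
apply: ler_pM; rewrite ?spectral_norm_ge0 //.
  apply: IHt; rewrite size_drop; apply: leq_trans wt.
  by rewrite ltn_subrL /= (leq_trans _ Tw).
by apply: le_trans betaT; apply: TP; rewrite size_takel.
Qed.

Lemma GUES_UED S Psi : realizes S Psi -> GUES S -> UED Psi.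
Proof.
move=> SPsi [beta [b01 [M BM] [Cg [Cg1 AC]]]]; have [b0 _] := andP b01.
exists beta; apply/UED_rateP; split=> //.
have Cg0 : 0 <= Cg by exact: le_trans Cg1.
exists (spectral_norm (sls_C S) * Cg * `|M|); split=> [|j w].
  by rewrite !mulr_ge0 ?spectral_norm_ge0.
rewrite SPsi -mulmxA; apply: (le_trans (l2norm_mulmx _ _)).
rewrite -!mulrA ler_wpM2l ?spectral_norm_ge0 //.
apply: (le_trans (l2norm_mulmx _ _)).
rewrite [`|M| * _]mulrC mulrA.
apply: ler_pM; rewrite ?spectral_norm_ge0 ?l2norm_ge0 ?AC //.
exact: le_trans (BM j) (ler_norm M).
Qed.

End Systems.

Unset Implicit Arguments.

Theorem mainTheorem1 (R : realType) (U J : Type) (hJ : inhabited J) (ny : nat)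
    (Psi : J -> seq U -> 'cV[R]_ny) :
  ((exists S : sls R U J ny, realizes S Psi /\ GUES S) <->
     (UD Psi /\ finite_hankel_rank Psi)) /\
  (forall beta : R, UED_rate Psi beta ->
     forall S : sls R U J ny, minimal_realization S Psi -> GUES_rate S beta) /\
  (finite_hankel_rank Psi -> UD Psi -> UED Psi).
Proof.
have stable : finite_hankel_rank Psi -> UD Psi ->
    exists S : sls R U J ny, realizes S Psi /\ GUES S.
  move=> [d Psi_d] PsiUD; have [S [Sd SPsi]] := hankel_realization Psi_d.
  exists S; split=> //; apply: UD_GUES PsiUD => //.
  by rewrite Sd.
split; [split|split].
- move=> [S [SPsi SGUES]]; split; first exact/UED_UD/(GUES_UED SPsi).
  by have [d _ Psi_d] := finite_hankel_rank_realizes SPsi; exists d.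
- by move=> [PsiUD Psi_fin]; exact: stable.
- move=> beta PsiUED S Smin; apply: UED_GUES_rate PsiUED; first exact: (proj1 Smin).
  exact: minimal_hankel_rank.
- move=> Psi_fin PsiUD; have [S [SPsi SGUES]] := stable Psi_fin PsiUD.
  exact: GUES_UED SGUES.
Qed.
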